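(* Let $A\in\mathbb{R}^{m\times n}$, $b\in\mathbb{R}^m$, $\varepsilon\ge 0$ and $0<q\le 1$, and let $\|\cdot\|_f$ be either the $1$-norm or the $\infty$-norm on $\mathbb{R}^m$. Then there exists a constant $p_f^*(A,b,q)>0$ (which may depend on $\varepsilon$) such that, whenever $0<p<p_f^*(A,b,q)$, every solution (global minimizer) of $$\min_{x\in\mathbb{R}^n}\|x\|_{h_{p,q}}\quad\text{s.t. }\|Ax-b\|_f\le\varepsilon$$ is a solution (global minimizer) of $$\min_{x\in\mathbb{R}^n}\|x\|_{0}\quad\text{s.t. }\|Ax-b\|_f\le\varepsilon .$$
   Context: For $p>0$ and $0<q\le 1$ let $h_{p,q}(t)=\log\left(1+|t|^q/p\right)$ for $t\in\mathbb{R}$, and for $x\in\mathbb{R}^n$ let $\|x\|_{h_{p,q}}=\sum_{i=1}^n h_{p,q}(x_i)$. $\|x\|_0$ denotes the number of non-zero entries of $x$. *)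

(* Defs.v *)
From HB Require Import structures.
From mathcomp Require Import all_boot all_order all_algebra.
From mathcomp Require Import all_classical all_reals all_analysis.

Set Implicit Arguments.
Unset Strict Implicit.
Unset Printing Implicit Defensive.

Import Order.TTheory GRing.Theory Num.Theory.
Import numFieldNormedType.Exports.

Local Open Scope classical_set_scope.
Local Open Scope ring_scope.

(* [0 `^ q = 0] for [q != 0], so [hpq p q 0 = 0] as soon as [0 < q]. *)
Definition hpq (R : realType) (p q t : R) : R := ln (1 + `|t| `^ q / p).

Definition hpq_sum (R : realType) (n : nat) (p q : R) (x : 'cV[R]_n) : R :=
  \sum_(i < n) hpq p q (x i 0).

Definition norm0 (R : realType) (n : nat) (x : 'cV[R]_n) : nat :=
  #|[set i : 'I_n | x i 0 != 0]%SET|.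

Definition norm1 (R : realType) (m : nat) (y : 'cV[R]_m) : R :=
  \sum_(i < m) `|y i 0|.

(* The norm MathComp-Analysis puts on matrices is the maximum of the absolute
   values of the entries (see [mx_normrE]). *)
Definition norminf (R : realType) (m : nat) (y : 'cV[R]_m) : R := `|y|.

Definition feasible (R : realType) (m n : nat) (normf : 'cV[R]_m -> R)
    (A : 'M[R]_(m, n)) (b : 'cV[R]_m) (eps : R) : set 'cV[R]_n :=
  [set x | normf (A *m x - b) <= eps].

Definition global_minimizer (U : Type) (d : Order.disp_t) (T : porderType d)
    (F : set U) (f : U -> T) (x : U) : Prop :=
  F x /\ forall y, F y -> (f x <= f y)%O.

(* Main.v *)
(* For q <= 1 the penalty is strictly concave on each half-line, and the
   feasible set is a polyhedron.  If two penalty minimizers, possibly for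
   different values of p, had the same support and the same active constraints,
   one of them could be moved both ways along the line joining them, which
   strict concavity forbids.  So the minimizers for all p form a finite set and
   their nonzero entries are bounded below by some r > 0 independent of p.  As
   p tends to 0 the ratio of (k + 1) log(1 + r^q/p) to k log(1 + M^q/p) tends
   to (k + 1)/k, so for small p a minimizer cannot have more than k nonzero
   entries, k being the minimal number of nonzero entries. *)
Require Import Defs.
From mathcomp Require Import all_boot all_order all_algebra.
From mathcomp Require Import all_classical all_reals all_analysis.
From mathcomp Require Import ring lra.

Set Implicit Arguments.
Unset Strict Implicit.
Unset Printing Implicit Defensive.

Import Order.TTheory GRing.Theory Num.Theory.
Import numFieldNormedType.Exports.

Local Open Scope classical_set_scope.
Local Open Scope ring_scope.

Lemma fin_pos_lbound (R : realType) (I : finType) (a : I -> R) :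
  (forall i, 0 < a i) -> exists r : R, 0 < r /\ forall i, r <= a i.
Proof.
(* The default value 1 covers an empty [I]. *)
move=> a_gt0; exists (\big[Num.min/1]_i a i); split.
  by apply: lt_bigmin => // i _; exact: a_gt0.
by move=> i; exact: bigmin_le.
Qed.

(* Obtained from the convexity of the power function with exponent 1/q >= 1. *)
Lemma powR_midpoint_ge (R : realType) (q u v : R) :
  0 < q -> q <= 1 -> 0 <= u -> 0 <= v ->
  (u `^ q + v `^ q) / 2 <= ((u + v) / 2) `^ q.
Proof.
move=> q_gt0 q_le1 u_ge0 v_ge0.
have qN0 : q != 0 by rewrite gt_eqF.
have Vq1 : 1 <= q^-1 by rewrite invf_ge1.
have powK (w : R) : 0 <= w -> (w `^ q) `^ q^-1 = w.
  by move=> w_ge0; rewrite -powRrM divff// powRr1.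
have half01 : (0 : R) <= 2^-1 /\ (2^-1 : R) <= 1 by split; lra.
have := convex_powR Vq1 (Itv01 half01.1 half01.2) (x := u `^ q) (y := v `^ q).
rewrite !inE /= !in_itv /= !andbT !powR_ge0 => /(_ isT isT).
rewrite convRE [X in X `^ _ <= _]convRE/= !powK//.
have -> : unstable.onem (2^-1 : R) = 2^-1 by rewrite /unstable.onem; lra.
rewrite -!mulrDr ![2^-1 * _]mulrC => le_avg.
have avg_ge0 : 0 <= (u `^ q + v `^ q) / 2.
  by rewrite divr_ge0// addr_ge0 ?powR_ge0.
have m_ge0 : 0 <= (u + v) / 2 by rewrite divr_ge0// addr_ge0.
rewrite -[leLHS](powRr1 avg_ge0) -[X in _ `^ X <= _](mulVf qN0) powRrM.
by apply: (ge0_ler_powR (ltW q_gt0) _ _ le_avg); rewrite nnegrE ?powR_ge0.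
Qed.

(** * Strict midpoint concavity of the penalty *)

Section Penalty.
Context {R : realType} {p q : R}.
Hypotheses (p_gt0 : 0 < p) (q_gt0 : 0 < q) (q_le1 : q <= 1).

Lemma hpq_arg_gt0 (t : R) : 0 < 1 + `|t| `^ q / p.
Proof. by rewrite ltr_pwDl// divr_ge0 ?powR_ge0// ltW. Qed.

Lemma hpq_ge0 (t : R) : 0 <= hpq p q t.
Proof. by rewrite /hpq ln_ge0// lerDl divr_ge0 ?powR_ge0// ltW. Qed.

Lemma hpq0 : hpq p q 0 = 0.
Proof. by rewrite /hpq normr0 powR0 ?gt_eqF// mul0r addr0 ln1. Qed.

Lemma hpq_le (s t : R) : `|s| <= `|t| -> hpq p q s <= hpq p q t.
Proof.
move=> st; rewrite /hpq ler_ln ?posrE ?hpq_arg_gt0// lerD2l.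
by rewrite ler_pM2r ?invr_gt0// ge0_ler_powR ?nnegrE ?normr_ge0// ltW.
Qed.

(** With a = u^q, b = v^q, c = ((u+v)/2)^q, this says (1 + a/p)(1 + b/p) < (1 + c/p)^2. The terms in
    1/p compare by a + b <= 2c, those in 1/p^2 by a b < c^2, which is strict AM-GM for u and v;
    hence strictness even at q = 1. *)
Lemma hpq_strict_midpoint_pos (u v : R) : 0 <= u -> 0 <= v -> u != v ->
  hpq p q u + hpq p q v < hpq p q ((u + v) / 2) *+ 2.
Proof.
move=> u_ge0 v_ge0 uv.
have m_ge0 : 0 <= (u + v) / 2 by lra.
have hu := hpq_arg_gt0 u; have hv := hpq_arg_gt0 v.
have hm := hpq_arg_gt0 ((u + v) / 2).
rewrite /hpq -lnM ?posrE// -lnXn// ltr_ln ?posrE ?mulr_gt0 ?exprn_gt0//.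
rewrite !ger0_norm//.
have mid := powR_midpoint_ge q_gt0 q_le1 u_ge0 v_ge0.
have ltM : u `^ q * v `^ q < ((u + v) / 2) `^ q * ((u + v) / 2) `^ q.
  rewrite -!powRM//; apply: gt0_ltr_powR; rewrite ?nnegrE ?(mulr_ge0 u_ge0)//.
    exact: mulr_ge0.
  have : 0 < (u - v) ^+ 2 by rewrite exprn_even_gt0//= subr_eq0.
  by nra.
have ip : 0 < p^-1 by rewrite invr_gt0.
move: mid ltM ip; set c := ((u + v) / 2) `^ q.
move: (u `^ q) (v `^ q) c (p^-1) => a b c e mid ltM ip.
have h1 : 0 <= (2 * c - a - b) * e by apply: mulr_ge0; lra.
have h2 : 0 < (c * c - a * b) * e ^+ 2.
  by apply: mulr_gt0; [lra | exact: exprn_gt0].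
by nra.
Qed.

(** The bound on [e] keeps t + e and t - e on the same side of 0 as t; evenness of the penalty
    reduces to t >= 0. *)
Lemma hpq_strict_midpoint (t e : R) : e != 0 -> `|e| <= `|t| ->
  hpq p q (t + e) + hpq p q (t - e) < hpq p q t *+ 2.
Proof.
have hN s : hpq p q (- s) = hpq p q s by rewrite /hpq normrN.
have pos s : 0 <= s -> e != 0 -> `|e| <= s ->
    hpq p q (s + e) + hpq p q (s - e) < hpq p q s *+ 2.
  move=> s_ge0 e_neq0 es; have /andP[] : - s <= e <= s by rewrite -ler_norml.
  move=> le1 le2; have {3}-> : s = ((s + e) + (s - e)) / 2 by lra.
  apply: hpq_strict_midpoint_pos; [lra|lra|].
  by apply/eqP => h; move/eqP: e_neq0; apply; lra.
move=> e_neq0; case: (leP 0 t) => t0.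
  by rewrite (ger0_norm t0); exact: pos.
rewrite (ltr0_norm t0) -(hN (t + e)) -(hN (t - e)) -(hN t) => et.
by rewrite opprD opprB addrC [e - t]addrC; apply: pos => //; lra.
Qed.

End Penalty.

(** * Finiteness of the set of minimizers over a polyhedron *)

Section Minimizers.
Context {R : realType} {n : nat} {S : finType}.
Variables (K : S -> 'cV[R]_n -> R) (eps q : R).
Hypotheses (q_gt0 : 0 < q) (q_le1 : q <= 1).
Hypothesis K_affine : forall s x y t,
  K s (x + t *: (y - x)) = K s x + t * (K s y - K s x).

Let F : set 'cV[R]_n := [set z | forall s, K s z <= eps].

(** The values lie in a finite type, so they can index the minimizers for all p at once. *)
Definition supp_active (x : 'cV[R]_n) : {set 'I_n} * {set S} :=
  ([set i | x i 0 != 0]%SET, [set s | K s x == eps]%SET).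

(* The denominators 1 + |..| only avoid a case distinction on vanishing
   slopes. *)
Lemma line_step (x y : 'cV[R]_n) : F x -> supp_active x = supp_active y ->
  exists2 d : R, 0 < d &
    (forall t, `|t| <= d -> F (x + t *: (y - x))) /\
    (forall i, `|d * (y i 0 - x i 0)| <= `|x i 0|).
Proof.
move=> Fx [/setP suppE /setP actE].
(* [r1] is a step within the slack of every inactive constraint; active ones are active at [y] too,
   hence constant along the line. *)
have [r1 [r1_gt0 r1P]] : exists r : R, 0 < r /\ forall s,
    r <= if K s x == eps then 1 else (eps - K s x) / (1 + `|K s y - K s x|).
  apply: fin_pos_lbound => s; case: ifPn => // Ks.
  by rewrite divr_gt0 ?subr_gt0 ?ltr_pwDl// lt_neqAle Ks Fx.
(* [r2] keeps nonzero entries from changing sign; zero entries of [x] are zero in [y] and do not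
   move. *)
have [r2 [r2_gt0 r2P]] : exists r : R, 0 < r /\ forall i,
    r <= if x i 0 == 0 then 1 else `|x i 0| / (1 + `|y i 0 - x i 0|).
  apply: fin_pos_lbound => i; case: ifPn => // xi.
  by rewrite divr_gt0 ?ltr_pwDl// normr_gt0.
exists (Num.min r1 r2); first by rewrite lt_min r1_gt0.
split=> [t | i].
  rewrite le_min => /andP[tr1 _] s; rewrite K_affine.
  have := r1P s; case: ifPn => [/eqP Ks _ | Ks].
    have := actE s; rewrite !inE Ks eqxx => /esym/eqP ->.
    by rewrite subrr mulr0 addr0.
  rewrite ler_pdivlMr ?ltr_pwDl// => r1s.
  have : t * (K s y - K s x) <= `|t| * `|K s y - K s x|.
    by rewrite -normrM ler_norm.
  have := normr_ge0 (K s y - K s x); have := normr_ge0 t.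
  by move: tr1 r1s r1_gt0; nra.
have := r2P i; case: ifPn => [/eqP xi _ | xi].
  have := suppE i; rewrite !inE xi eqxx => /esym/negbFE/eqP ->.
  by rewrite subrr mulr0 normr0.
rewrite ler_pdivlMr ?ltr_pwDl// => r2s.
rewrite normrM ger0_norm ?le_min ?ltW//.
have : Num.min r1 r2 <= r2 by rewrite ge_min lexx orbT.
have := normr_ge0 (y i 0 - x i 0); have := normr_ge0 (x i 0).
by move: r2s r2_gt0; nra.
Qed.

(** If x and y differ, x is the midpoint of two feasible points x + d(y - x) and x - d(y - x) whose
    penalties sum to less than twice that of x. Only the minimality of x is contradicted, so y may
    be a minimizer for another p. *)
Lemma minimizer_supp_active_inj (p : R) (x y : 'cV[R]_n) : 0 < p ->
  global_minimizer F (hpq_sum p q) x -> supp_active x = supp_active y -> x = y.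
Proof.
move=> p_gt0 [Fx xmin] sig.
have [d d_gt0 [Fline small]] := line_step Fx sig.
apply/eqP/negPn/negP => xy.
have [i di] : exists i, y i 0 - x i 0 != 0.
  apply/existsP; apply: contraR xy; rewrite negb_exists => /forallP h.
  apply/eqP/matrixP => i j; rewrite ord1; apply/eqP.
  by have := h i; rewrite negbK subr_eq0 eq_sym.
have xp := xmin _ (Fline d _); have xm := xmin _ (Fline (- d) _).
rewrite ?normrN (gtr0_norm d_gt0) lexx in xp xm.
have {xp xm} := lerD (xp isT) (xm isT).
rewrite -mulr2n leNgt => /negP; apply.
rewrite /hpq_sum -big_split/= -sumrMnl.
have termE j : hpq p q ((x + d *: (y - x)) j 0) +
    hpq p q ((x + - d *: (y - x)) j 0) =
    hpq p q (x j 0 + d * (y j 0 - x j 0)) +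
    hpq p q (x j 0 - d * (y j 0 - x j 0)) by rewrite !mxE mulNr.
rewrite (eq_bigr _ (fun j _ => termE j)).
rewrite (bigD1 i)//= [ltRHS](bigD1 i)//=; apply: ltr_leD.
  by apply: hpq_strict_midpoint => //; rewrite (mulf_neq0 _ di) ?lt0r_neq0.
apply: ler_sum => j _; have [dj|dj] := eqVneq (d * (y j 0 - x j 0)) 0.
  by rewrite dj subr0 addr0 mulr2n.
by apply/ltW/hpq_strict_midpoint.
Qed.

Lemma minimizer_entry_lbound : exists r : R, 0 < r /\
  forall p x i, 0 < p -> global_minimizer F (hpq_sum p q) x ->
    x i 0 != 0 -> r <= `|x i 0|.
Proof.
pose P (k : ({set 'I_n} * {set S}) * 'I_n) (a : R) := 0 < a /\
  forall p x, 0 < p -> global_minimizer F (hpq_sum p q) x ->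
    supp_active x = k.1 -> x k.2 0 != 0 -> a <= `|x k.2 0|.
have /fin_all_exists[a aP] : forall k, exists a, P k a.
  move=> [sg i].
  have [[p [x [p_gt0 xmin sgx xi]]]|none] := pselect (exists p x,
      [/\ 0 < p, global_minimizer F (hpq_sum p q) x,
          supp_active x = sg & x i 0 != 0]).
    (* Every minimizer with this pattern, for whatever p', equals [x]. *)
    exists `|x i 0|; split; first by rewrite normr_gt0.
    move=> p' x' p'_gt0 _ sgx' _ /=.
    by rewrite (minimizer_supp_active_inj (y := x') p_gt0 xmin)// sgx.
  exists 1; split=> // p x p_gt0 xmin sgx xi; case: none.
  by exists p, x.
have [r [r_gt0 rP]] := @fin_pos_lbound _ _ a (fun k => (aP k).1).
exists r; split=> // p x i p_gt0 xmin xi.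
apply: le_trans (rP (supp_active x, i)) _.
exact: (aP (supp_active x, i)).2 p_gt0 xmin _ xi.
Qed.

End Minimizers.

(** * Comparison of the penalty with the number of nonzero entries *)

Lemma hpq_sum_norm0_ge (R : realType) (n : nat) (p q r : R) (x : 'cV[R]_n) :
  0 < p -> 0 < q -> 0 < r -> (forall i, x i 0 != 0 -> r <= `|x i 0|) ->
  hpq p q r *+ norm0 x <= hpq_sum p q x.
Proof.
move=> p_gt0 q_gt0 r_gt0 xr; rewrite /hpq_sum /norm0 -sumr_const.
rewrite big_mkcond/=; apply: ler_sum => i _; rewrite inE.
case: ifPn => xi; last exact: hpq_ge0.
by apply: hpq_le => //; rewrite gtr0_norm ?xr.
Qed.

Lemma hpq_sum_norm0_le (R : realType) (n : nat) (p q M : R) (x : 'cV[R]_n) :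
  0 < p -> 0 < q -> (forall i, `|x i 0| <= M) ->
  hpq_sum p q x <= hpq p q M *+ norm0 x.
Proof.
move=> p_gt0 q_gt0 xM; rewrite /hpq_sum /norm0 -sumr_const.
rewrite [leRHS]big_mkcond/=; apply: ler_sum => i _; rewrite inE.
case: ifPn => [_|/negPn/eqP ->]; last by rewrite hpq0.
by apply: hpq_le => //; rewrite (le_trans (xM i))// ler_norm.
Qed.

Lemma hpq_separation (R : realType) (q r M : R) (k : nat) :
  0 < r -> exists pstar : R, 0 < pstar /\ forall p, 0 < p -> p < pstar ->
    hpq p q M *+ k < hpq p q r *+ k.+1.
Proof.
move=> r_gt0; have a_gt0 : 0 < `|r| `^ q by rewrite powR_gt0 ?normr_gt0 ?gt_eqF.
have b_ge0 : 0 <= `|M| `^ q by exact: powR_ge0.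
pose C := 1 + `|M| `^ q / `|r| `^ q.
have C_ge1 : 1 <= C by rewrite lerDl divr_ge0// ltW.
have C_gt0 : 0 < C by exact: lt_le_trans C_ge1.
(* Since 1 + |M|^q/p <= C (1 + |r|^q/p), it suffices that C^k < 1 + |r|^q/p, which this threshold
   ensures. *)
exists (`|r| `^ q / C ^+ k); split; first by rewrite divr_gt0 ?exprn_gt0.
move=> p p_gt0; rewrite ltr_pdivlMr ?exprn_gt0// => pC.
have hr := hpq_arg_gt0 (q := q) p_gt0 r.
have hM := hpq_arg_gt0 (q := q) p_gt0 M.
rewrite /hpq -!lnXn// ltr_ln ?posrE ?exprn_gt0//.
have le_C : 1 + `|M| `^ q / p <= C * (1 + `|r| `^ q / p).
  rewrite mulrDr mulr1 lerD// /C mulrDl mul1r mulrA divfK ?gt_eqF// lerDr.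
  by rewrite divr_ge0// ltW.
apply: (@le_lt_trans _ _ ((C * (1 + `|r| `^ q / p)) ^+ k)).
  by rewrite lerXn2r ?nnegrE ?(ltW hM)// mulr_ge0 ?(ltW hr) ?(ltW C_gt0).
rewrite exprMn exprS ltr_pM2r ?exprn_gt0//.
apply: (@lt_trans _ _ (`|r| `^ q / p)); last by rewrite ltrDr.
by rewrite ltr_pdivlMr// mulrC.
Qed.

(* For the 1-norm the functionals are the sign vectors, for the max norm the
   signed coordinates. *)
Lemma norm_le_polyhedral (R : realType) (m : nat) (normf : 'cV[R]_m -> R) :
  normf = @norm1 R m \/ normf = @norminf R m ->
  exists (S : finType) (w : S -> 'rV[R]_m), forall y eps, 0 <= eps ->
    normf y <= eps <-> forall s, (w s *m y) 0 0 <= eps.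
Proof.
case=> ->.
  exists {ffun 'I_m -> bool},
    (fun s : {ffun 'I_m -> bool} => \row_j (-1) ^+ s j) => y eps _.
  split=> [y_le s | ].
    apply: le_trans y_le; rewrite mxE; apply: ler_sum => j _; rewrite mxE.
    by rewrite (le_trans (ler_norm _))// normrM normr_sign mul1r.
  (* The sign pattern of [y] itself attains the 1-norm. *)
  move=> /(_ [ffun j => y j 0 < 0]); apply: le_trans.
  rewrite mxE; apply: ler_sum => j _; rewrite mxE ffunE.
  case: ltP => y0 /=.
    by rewrite ltr0_norm// expr1 mulN1r.
  by rewrite ger0_norm// expr0 mul1r.
exists ('I_m * bool)%type,
  (fun s : 'I_m * bool => (-1) ^+ s.2 *: delta_mx 0 s.1) => y eps e0.
have wE (s : 'I_m * bool) :
    (((-1) ^+ s.2 *: delta_mx 0 s.1 : 'rV[R]_m) *m y) 0 0 =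
    (-1) ^+ s.2 * y s.1 0 by rewrite -scalemxAl mxE -rowE mxE.
rewrite /norminf /Num.Def.normr/= mx_normrE.
split=> [/bigmax_leP[_ y_le] s | y_le].
  rewrite wE (le_trans (ler_norm _))// normrM normr_sign mul1r.
  exact: (y_le (s.1, 0)).
(* The maximum starts from the default value 0, which is where [0 <= eps] enters. *)
apply/bigmax_leP; split=> // -[j l] _ /=; rewrite ord1 ler_norml.
have := y_le (j, false); have := y_le (j, true); rewrite !wE/= expr1 expr0.
by rewrite mulN1r mul1r lerNl => -> ->.
Qed.

Theorem corollary1 (R : realType) (m n : nat) (A : 'M[R]_(m, n))
    (b : 'cV[R]_m) (eps q : R) (normf : 'cV[R]_m -> R)
    (eps_ge0 : 0 <= eps) (q_gt0 : 0 < q) (q_le1 : q <= 1)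
    (normfE : normf = @norm1 R m \/ normf = @norminf R m) :
  exists pstar : R, 0 < pstar /\
    forall p : R, 0 < p -> p < pstar ->
    forall x : 'cV[R]_n,
      global_minimizer (feasible normf A b eps) (hpq_sum p q) x ->
      global_minimizer (feasible normf A b eps) (@norm0 R n) x.
Proof.
have [S [w wP]] := norm_le_polyhedral normfE.
pose K (s : S) (z : 'cV[R]_n) := (w s *m (A *m z - b)) 0 0.
have K_affine s x y t : K s (x + t *: (y - x)) = K s x + t * (K s y - K s x).
  rewrite /K !mulmxBr mulmxDr mulmxDr -!scalemxAr !mulmxBr !mxE; ring.
have -> : feasible normf A b eps = [set z | forall s, K s z <= eps].
  by apply/seteqP; split=> z /(wP _ _ eps_ge0).
set F := [set z | _].
(* Without feasible points there are no minimizers, and any threshold works. *)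
have [[z0 Fz0]|F0] := pselect (exists z, F z); last first.
  exists 1; split=> // p _ _ x [Fx _]; case: F0; by exists x.
have [y Fy ymin] : exists2 y, F y & forall z, F z -> (norm0 y <= norm0 z)%N.
  have exk : exists k, `[< exists2 z, F z & norm0 z = k >].
    by exists (norm0 z0); apply/asboolP; exists z0.
  case: (ex_minnP exk) => k /asboolP[y Fy <-] kmin; exists y => // z Fz.
  by apply: kmin; apply/asboolP; exists z.
have [r [r_gt0 rP]] := minimizer_entry_lbound eps q_gt0 q_le1 K_affine.
have [M yM] : exists M, forall i, `|y i 0| <= M.
  exists (\sum_i `|y i 0|) => i; rewrite (bigD1 i)//= lerDl.
  exact: sumr_ge0.
have [pstar [pstar_gt0 sep]] := hpq_separation q M (norm0 y) r_gt0.
exists pstar; split=> // p p_gt0 p_lt x xmin; split; first exact: xmin.1.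
(* If x had at least k + 1 nonzero entries, where k = [norm0 y], then (k + 1) h(r) <= penalty of x
   <= penalty of y <= k h(M), against [sep]. *)
move=> z /ymin; apply: leq_trans; rewrite leqNgt; apply/negP => yx.
have := sep p p_gt0 p_lt; apply/negP; rewrite -leNgt.
apply: le_trans (hpq_sum_norm0_le p_gt0 q_gt0 yM).
apply: le_trans (xmin.2 _ Fy).
have xr i := rP p x i p_gt0 xmin.
apply: le_trans (hpq_sum_norm0_ge p_gt0 q_gt0 r_gt0 xr).
by rewrite ler_wpMn2l// hpq_ge0.
Qed.
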